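(* Let $P_0,P_1$ be probability measures on $(\mathcal X,\mathcal B_{\mathcal X})$ with $P_1\ll P_0$, $\mathrm{KL}(P_1\|P_0)<\infty$, and let $R=\frac{dP_1}{dP_0}$; work in the i.i.d. model. Fix $\beta>0$ with $Z_\beta:=\mathbb E_{P_0}[R^\beta]<\infty$, and $\alpha\in(0,1)$ with $\ell:=\log\frac1\alpha$, and let $W_t=\prod_{n\le t}R_\beta(X_n)$ be the i.i.d. product generated by $R_\beta:=R^\beta/Z_\beta$. With $\lambda(\beta):=-\frac1\beta\log Z_\beta$, $G_t:=\sum_{n\le t}\log R(X_n)$ and $B_t(\beta):=\frac\ell\beta-t\lambda(\beta)$, for every $t\in\mathbb N$: (a) $\log W_t=\beta\big(G_t-B_t(\beta)\big)+\ell$, and consequently $$\gamma_t(\alpha)=\mathbb P_1\big(G_t\le B_t(\beta)\big),\qquad\bar\gamma_t(\alpha)=\mathbb P_1\big(G_n\le B_n(\beta)\text{ for all }n\le t\big);$$ (b) the whole family $(R_\beta)$, over all $\beta>0$ with $Z_\beta<\infty$, therefore performs the same test (reject when the log-likelihood-ratio sum $G_t$ exceeds a threshold) and differs only in where the threshold is put; (c) $\gamma_t(\alpha)\ge\mathbb P_1\big(G_t\le\mathbb E_{P_1}[G_t]\big)$ whenever $t\,c_\beta\le\ell$ (in particular at every $t$ when $c_\beta\le0$), where $c_\beta:=\mathbb E_{P_1}[\log R_\beta]$; and the surrogate bound $\gamma_t(\alpha)\le e^{B_t(\beta)}$ is vacuous unless $\lambda(\beta)>0$ (that is, unless $\beta<1$)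 and $t>\ell/(\beta\lambda(\beta))$. (The Chernoff bound $\gamma_t(\alpha)\le\exp(s\ell-t\Lambda_s(R_\beta))$ at $s=\frac1\beta$, where $\Lambda_s(E):=-\log\mathbb E_{P_1}[E^{-s}]$, is $e^{B_t(\beta)}P_0(R>0)^t$, which is smaller when $P_0(R>0)<1$; the two agree under $\mathrm{KL}(P_0\|P_1)<\infty$.)
   Context: I.i.d. model: $\Omega=\mathcal X^{\mathbb N}$ with coordinates $X_n$, $\mathbb P_i=P_i^{\otimes\mathbb N}$; $\mathbb E_{P_1}[G_t]$ denotes the expectation of $G_t$ when the observations are i.i.d. from $P_1$, i.e. $t\,\mathrm{KL}(P_1\|P_0)$. $W_0=1$, $G_0=0$. $\tau_\alpha:=\inf\{t\in\mathbb N:W_t>\frac1\alpha\}$ ($\inf\emptyset=\infty$); $\gamma_t(\alpha):=\mathbb P_1(W_t\le\frac1\alpha)$ is the fixed-horizon type-II error and $\bar\gamma_t(\alpha):=\mathbb P_1(\tau_\alpha>t)$ the sequential one. In (a) the condition ''for all $n\le t$'' ranges over $1\le n\le t$. ''Vacuous'' means that the bound is at least $1$, i.e. $B_t(\beta)\ge0$. Conventions: $\log0=-\infty$, $0^{-s}=+\infty$ for $s>0$.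
   Formalization: The equivalence of λ(β)>0 with β<1 is stated for P0≠P1 (if P0=P1 then λ(β)=0 for all β); λ(β)>0 implies β<1 always. That the Chernoff bound is strictly smaller when P0(R>0)<1 is stated for t≥1, since both bounds are equal at t=0. *)

(* Defs.v *)
From HB Require Import structures.
From mathcomp Require Import all_boot all_order all_algebra.
From mathcomp Require Import all_classical all_reals all_analysis.

Set Implicit Arguments.
Unset Strict Implicit.
Unset Printing Implicit Defensive.
Import Order.TTheory GRing.Theory Num.Theory.
Import numFieldNormedType.Exports.
Local Open Scope classical_set_scope.
Local Open Scope charge_scope.
Local Open Scope ring_scope.

Section sequence_space.
Context d (T : measurableType d) (R : realType).

Definition coordinate_sets : set (set (nat -> T)) :=
  [set C | exists (n : nat) (A : set T), measurable A /\ C = [set w | A (w n)]].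

(* The space of sequences with its product sigma-algebra. Sequences are indexed
   from 0, so that the n-th observation (n >= 1) of w is w n.-1, and the first t
   observations are w n for n < t. *)
Definition seqspace := g_sigma_algebraType coordinate_sets.

(* Q is the infinite product of copies of P. The finite-dimensional rectangles
   form a pi-system that generates the sigma-algebra, so Q is unique. *)
Definition is_iid_law (P : probability T R) (Q : probability seqspace R) : Prop :=
  forall (n : nat) (A : nat -> set T), (forall i, measurable (A i)) ->
    Q [set w | forall i, (i < n)%N -> A i (w i)] = (\prod_(i < n) P (A i))%E.

End sequence_space.

Section divergence.
Context d (T : measurableType d) (R : realType).
Local Open Scope ereal_scope.

Definition KL (P Q : probability T R) : \bar R :=
  if `[< P `<< Q >]
  then \int[P]_x lne (('d (charge_of_finite_measure P) '/d Q) x)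
  else +oo.

(* r is a [0, +oo[-valued measurable version of dP/dQ. *)
Definition is_RN_version (P Q : probability T R) (r : T -> R) : Prop :=
  [/\ forall x, (0 <= r x)%R, measurable_fun setT r &
      {ae Q, forall x, ('d (charge_of_finite_measure P) '/d Q) x = (r x)%:E}].

End divergence.

Section product_tests.
Context d (T : measurableType d) (R : realType).
Implicit Types (E : T -> R) (w : seqspace T) (t : nat).

Definition iid_product E t w : R := \prod_(n < t) E (w n).

(* ereal_inf set0 = +oo *)
Definition first_time (S : nat -> set (seqspace T)) w : \bar R :=
  ereal_inf [set t%:R%:E | t in [set t : nat | S t w]].

Definition rejection (alpha : R) (W : nat -> seqspace T -> R) t :
    set (seqspace T) :=
  [set w | alpha^-1 < W t w].

Definition stopping_time alpha W w : \bar R := first_time (rejection alpha W) w.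

Definition type2 (Q1 : probability (seqspace T) R) alpha
    (W : nat -> seqspace T -> R) t : \bar R :=
  Q1 [set w | W t w <= alpha^-1].

Definition seq_type2 (Q1 : probability (seqspace T) R) alpha W t : \bar R :=
  Q1 [set w | (t%:R%:E < stopping_time alpha W w)%E].

(* x ^ (-s) for x >= 0 and s > 0, with 0 ^ (-s) = +oo (powR sends 0 to 0). *)
Definition npowR (x s : R) : \bar R :=
  if x == 0 then +oo%E else (x `^ (- s))%:E.

Definition Lambda (P1 : probability T R) (s : R) E : \bar R :=
  (- lne (\int[P1]_x npowR (E x) s))%E.

Definition chernoff_bound (P1 : probability T R) (alpha s : R) E t : \bar R :=
  expeR ((s * ln alpha^-1)%:E - t%:R%:E * Lambda P1 s E)%E.

End product_tests.

Section power_family.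
Context d (T : measurableType d) (R : realType).
Variables (P0 : probability T R) (r : T -> R).
Implicit Types (alpha b : R) (w : seqspace T) (t : nat).

Definition Z b : \bar R := (\int[P0]_x (r x `^ b)%:E)%E.

Definition Rpow b (x : T) : R := r x `^ b / fine (Z b).

Definition W b : nat -> seqspace T -> R := iid_product (Rpow b).

Definition lambda b : R := - b^-1 * ln (fine (Z b)).

Definition threshold alpha b t : R := ln alpha^-1 / b - t%:R * lambda b.

(* The log-likelihood-ratio sum; lne 0 = -oo and no summand is +oo. *)
Definition G t w : \bar R := (\sum_(n < t) lne (r (w n))%:E)%E.

Definition llr_rejection (c : nat -> R) t : set (seqspace T) :=
  [set w | ((c t)%:E < G t w)%E].

Definition c_coef (P1 : probability T R) b : \bar R :=
  (\int[P1]_x lne (Rpow b x)%:E)%E.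

End power_family.

(* Main.v *)
(* Since [ln W_t = b * G_t - t * ln Z], the events [W_t <= 1/alpha] and
   [G_t <= B_t] coincide pointwise, including at [-oo]. The negative part of
   [ln r] is [P1]-integrable because [x * (- ln x) <= 1], so finiteness of
   KL(P1||P0) makes [ln r] integrable and both [E G_t] and [c_beta] explicit.
   The Chernoff bound needs only that [E] of a product over i.i.d. coordinates
   is a product: the law of (first coordinate, shifted sequence) is [P \x Q] by
   uniqueness on rectangles, then Fubini-Tonelli and induction on [t]. Finally
   [E_{P1}[1/r] = P0 (r > 0)] evaluates the bound at [s = 1/b], and comparing
   [r ^ b] with its tangent at [1] compares [Z] with [1]. *)
Require Import Defs.
From HB Require Import structures.
From mathcomp Require Import all_boot all_order all_algebra.
From mathcomp Require Import all_classical all_reals all_analysis.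
From mathcomp Require Import measurable_realfun ring lra.

Set Implicit Arguments.
Unset Strict Implicit.
Unset Printing Implicit Defensive.
Import Order.TTheory GRing.Theory Num.Theory.
Import numFieldNormedType.Exports.
Local Open Scope classical_set_scope.
Local Open Scope ring_scope.

Lemma integral_prob_cst d (T : measurableType d) (R : realType)
  (P : probability T R) (c : \bar R) : (\int[P]_x c = c)%E.
Proof.
transitivity (c * P setT)%E; first exact: integral_cst.
by rewrite probability_setT mule1.
Qed.

(** * Tangent of a real power *)

(** This is the weighted arithmetic-geometric mean inequality for [x] and [1] with weights [b] and
    [1 - b]. With [c] the arithmetic mean, add the inequalities [ln y <= y - 1] at [y = x / c] and
    [y = c^-1] with these weights: the right-hand sides cancel and [b * ln x <= ln c] remains. *)
Lemma powR_tangent_lt (R : realType) (x b : R) :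
  0 <= x -> x != 1 -> 0 < b < 1 -> x `^ b < 1 + b * (x - 1).
Proof.
move=> x0 x1 /andP[b0 b1].
have [->|xn0] := eqVneq x 0; first by rewrite powR0 ?gt_eqF//; lra.
have {x0 xn0} xgt0 : 0 < x by rewrite lt_neqAle eq_sym xn0.
pose c := 1 + b * (x - 1).
have c0 : 0 < c by rewrite /c; have := mulr_gt0 b0 xgt0; lra.
rewrite -/c -ltr_ln ?posrE ?powR_gt0// ln_powR.
have tangent (y : R) : 0 < y -> ln y <= y - 1.
  move=> y0; have -> : ln y = ln (1 + (y - 1)) by congr ln; lra.
  by apply: le_ln1Dx; lra.
have tangent_lt (y : R) : 0 < y -> y != 1 -> ln y < y - 1.
  move=> y0 y1; have : ln y != 0 by rewrite ln_eq0.
  by move=> /expR_gt1Dx; rewrite lnK ?posrE//; lra.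
have Hx : ln (x / c) <= x / c - 1 by rewrite tangent ?divr_gt0.
have H1 : ln c^-1 <= c^-1 - 1 by rewrite tangent ?invr_gt0.
have E : b * (x / c) + (1 - b) * c^-1 = 1.
  have -> : b * (x / c) + (1 - b) * c^-1 = (1 + b * (x - 1)) / c by field; lra.
  by rewrite divff ?gt_eqF.
have Lx : ln (x / c) = ln x - ln c by rewrite ln_div ?posrE.
have L1 : ln c^-1 = - ln c by rewrite lnV ?posrE.
rewrite Lx in Hx; rewrite L1 in H1.
(* Strictness comes from [ln y < y - 1] at a point [y != 1]: at [x] itself when [c = 1], where the
   inequality at [c^-1] degenerates, and at [c^-1] otherwise. *)
have [c1|cn1] := eqVneq c 1.
  have {Lx E} := tangent_lt _ xgt0 x1.
  rewrite c1 ln1 -subr_gt0 -(pmulr_rgt0 _ b0).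
  have : b * (x - 1) = 0 by move: c1; rewrite /c; lra.
  by lra.
have := tangent_lt c^-1; rewrite invr_gt0 invr_eq1 L1 => /(_ c0 cn1).
have b1' : 0 < 1 - b by lra.
rewrite -subr_gt0 -(pmulr_rgt0 _ b1') => H2.
have : 0 <= b * (x / c - 1 - (ln x - ln c)) by rewrite mulr_ge0 ?subr_ge0// ltW.
by nra.
Qed.

Lemma powR_tangent_le (R : realType) (x b : R) :
  0 <= x -> 0 < b <= 1 -> x `^ b <= 1 + b * (x - 1).
Proof.
move=> x0 /andP[b0]; rewrite le_eqVlt => /predU1P[->|b1].
  by rewrite powRr1//; lra.
have [->|x1] := eqVneq x 1; first by rewrite powR1; lra.
by rewrite ltW// powR_tangent_lt// b0.
Qed.

(** Reduces to the concave case: a positive tangent value, raised to the exponent [b^-1 <= 1], is at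
    most [x], and raising both sides to the exponent [b] concludes. A nonpositive tangent value is
    trivially below the power. *)
Lemma powR_tangent_ge (R : realType) (x b : R) :
  0 <= x -> 1 <= b -> 1 + b * (x - 1) <= x `^ b.
Proof.
move=> x0 b1; have b0 : 0 < b by lra.
have [c0|c0] := leP (1 + b * (x - 1)) 0.
  exact: (le_trans c0 (powR_ge0 _ _)).
have := @powR_tangent_le R (1 + b * (x - 1)) b^-1 (ltW c0).
rewrite invr_gt0 b0 invf_le1// b1 => /(_ isT).
have -> : 1 + b^-1 * (1 + b * (x - 1) - 1) = x by field; lra.
move=> /(@ge0_ler_powR R b (ltW b0) _ _).
rewrite !nnegrE powR_ge0 => /(_ isT x0).
by rewrite -powRrM mulVf ?gt_eqF// powRr1// ltW.
Qed.

(** * I.i.d. sequences *)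

Section sequence_space_lemmas.
Context d (T : measurableType d) (R : realType).
Local Open Scope ereal_scope.

Lemma measurable_coordinate (n : nat) :
  measurable_fun setT (fun w : seqspace T => w n).
Proof.
move=> _ A mA; rewrite setTI; apply: sub_sigma_algebra.
by exists n, A.
Qed.

Lemma measurable_seqspace d' (T' : measurableType d') (f : T' -> seqspace T) :
  (forall n, measurable_fun setT (fun x => f x n)) -> measurable_fun setT f.
Proof.
move=> mf.
refine (@measurability _ _ _ (seqspace T) setT f (@coordinate_sets _ T) _ _) => //.
move=> _ [_ [n [A [mA ->]]] <-]; exact: mf.
Qed.

Definition shift (w : seqspace T) : seqspace T := fun n => w n.+1.

Lemma measurable_shift : measurable_fun setT shift.
Proof.
by apply: measurable_seqspace => n; exact: measurable_coordinate.
Qed.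

Definition rectangle (n : nat) (A : nat -> set T) : set (seqspace T) :=
  [set w | forall i, (i < n)%N -> A i (w i)].

Lemma measurable_rectangle n A :
  (forall i, measurable (A i)) -> measurable (rectangle n A).
Proof.
move=> mA.
have -> : rectangle n A =
    \bigcap_(i < n) ((fun w : seqspace T => w i) @^-1` A i).
  by apply/seteqP; split.
apply: fin_bigcap_measurable => // i _.
by rewrite -[X in measurable X]setTI; exact: measurable_coordinate.
Qed.

Definition rectangles : set (set (seqspace T)) :=
  [set C | exists n A, (forall i, measurable (A i)) /\ C = rectangle n A].

(** Padding with full sides brings two rectangles to a common length, so that they can be
    intersected side by side. *)
Lemma rectangle_extend n m A : (n <= m)%N ->
  rectangle n A = rectangle m (fun i => if (i < n)%N then A i else setT).
Proof.
move=> nm; apply/seteqP; split => w wA i im; first by case: ifPn => // /wA.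
by have := wA i (leq_trans im nm); rewrite im.
Qed.

Lemma setI_closed_rectangles : setI_closed rectangles.
Proof.
move=> _ _ [n [A [mA ->]]] [m [B [mB ->]]].
rewrite (rectangle_extend _ (leq_maxl n m)) (rectangle_extend _ (leq_maxr n m)).
set A' := fun i => _; set B' := fun i => if (i < m)%N then _ else _.
exists (maxn n m), (fun i => A' i `&` B' i); split.
  by move=> i; apply: measurableI; rewrite /A' /B'; case: ifPn.
by apply/seteqP; split=> [w [wA wB] i im|w wAB]; [split; [exact: wA|exact: wB]|
   split=> i im; have [] := wAB i im].
Qed.

Lemma measurable_generated_by_rectangles :
  @measurable _ (seqspace T) = <<s rectangles >>.
Proof.
apply/seteqP; split; last first.
  apply: smallest_sub; first exact: sigma_algebra_measurable.
  by move=> _ [n [A [mA ->]]]; exact: measurable_rectangle.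
apply: smallest_sub; first exact: smallest_sigma_algebra.
move=> _ [n [A [mA ->]]]; apply: sub_sigma_algebra.
exists n.+1, (fun i => if i == n then A else setT); split.
  by move=> i; case: ifPn.
apply/seteqP; split=> w /= wA; last by have := wA n (leqnn _); rewrite eqxx.
by move=> i _; case: ifPn => // /eqP ->.
Qed.

Variables (P : probability T R) (Q : probability (seqspace T) R).
Hypothesis Q_iid : is_iid_law P Q.

Lemma iid_coordinate (n : nat) (A : set T) :
  measurable A -> Q [set w | A (w n)] = P A.
Proof.
move=> mA.
have := Q_iid n.+1 (A := fun i => if i == n then A else setT) _.
have -> : [set w : seqspace T | forall i, (i < n.+1)%N ->
    (if i == n then A else setT) (w i)] = [set w | A (w n)].
  apply/seteqP; split=> w /= wA; first by have := wA n (leqnn _); rewrite eqxx.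
  by move=> i _; case: ifPn => // /eqP ->.
move=> -> //; last by move=> i; case: ifPn.
rewrite big_ord_recr/= eqxx big1 ?mul1e// => i _.
by rewrite ltn_eqF// probability_setT.
Qed.

(** For fixed [A], both sides are finite measures in [C]. They agree on rectangles, because
    prepending the side [A] to a rectangle of length [n] gives one of length [n.+1]; the pi-system
    uniqueness theorem does the rest. *)
Lemma iid_shift_indep (A : set T) (C : set (seqspace T)) :
  measurable A -> measurable C ->
  Q ([set w | A (w 0%N)] `&` shift @^-1` C) = P A * Q C.
Proof.
move=> mA mC.
have mA0 : measurable [set w : seqspace T | A (w 0%N)].
  by rewrite -[X in measurable X]setTI; exact: measurable_coordinate.
have PA0 : (0 <= fine (P A))%R by rewrite fine_ge0.
have scaleE X : mscale (NngNum PA0) Q X = P A * Q X.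
  by rewrite /mscale/= fineK ?fin_num_measure.
have msh := measurable_shift.
have : pushforward (mrestr Q mA0) shift C = mscale (NngNum PA0) Q C.
  apply: (measure_unique rectangles (fun _ => setT)) => //.
  - exact: measurable_generated_by_rectangles.
  - exact: setI_closed_rectangles.
  - by move=> _; exists 0%N, (fun _ => setT); split => //; apply/seteqP; split.
  - by rewrite bigcup_const.
  - move=> _ [n [B [mB ->]]]; apply: etrans (esym (scaleE _)).
    rewrite [Q (rectangle n B)](Q_iid n mB).
    pose B' i := if i is j.+1 then B j else A.
    have mB' i : measurable (B' i) by case: i.
    have := Q_iid n.+1 mB'; rewrite big_ord_recl/= => <-.
    congr (Q _); apply/seteqP; split => w /=.
      by move=> [wB wA] [_ //|i]; rewrite ltnS => /wB.
    by move=> wB; split=> [i im|]; [exact: (wB i.+1)|exact: (wB 0%N)].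
  - move=> k; rewrite /= /pushforward /mrestr.
    by rewrite (le_lt_trans (probability_le1 _ _))// ?ltry// preimage_setT setTI.
by rewrite scaleE /pushforward /mrestr setIC.
Qed.

Lemma iid_shift_product (X : set (T * seqspace T)) : measurable X ->
  (P \x Q) X = Q ((fun w => (w 0%N, shift w)) @^-1` X).
Proof.
move=> mX.
have mphi : measurable_fun setT (fun w : seqspace T => (w 0%N, shift w)).
  apply: measurable_fun_pair; first exact: measurable_coordinate.
  exact: measurable_shift.
rewrite -[RHS]/(pushforward Q (fun w => (w 0%N, shift w)) X).
apply: product_measure_unique => // A B mA mB.
by rewrite -iid_shift_indep.
Qed.

Lemma ge0_integral_iid_coordinate (n : nat) (f : T -> \bar R) :
  measurable_fun setT f -> (forall x, 0 <= f x) ->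
  \int[Q]_w f (w n) = \int[P]_x f x.
Proof.
move=> mf f0.
have mn := @measurable_coordinate n.
rewrite -[LHS](@ge0_integral_pushforward _ _ _ _ R _ mn Q setT f)//.
by apply: eq_measure_integral => A mA _; rewrite /= -(iid_coordinate n mA).
Qed.

Lemma integral_iid_coordinate (n : nat) (f : T -> \bar R) :
  measurable_fun setT f -> \int[Q]_w f (w n) = \int[P]_x f x.
Proof.
move=> mf; rewrite [RHS]integralE [LHS]integralE.
pose c (w : seqspace T) := w n.
rewrite -[X in X^\+]/(f \o c) -[X in X^\-]/(f \o c) funepos_comp funeneg_comp.
rewrite (@ge0_integral_iid_coordinate _ f^\+)//; last exact: measurable_funepos.
by rewrite (@ge0_integral_iid_coordinate _ f^\-)//; exact: measurable_funeneg.
Qed.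

Lemma integrable_iid_coordinate (n : nat) (f : T -> \bar R) :
  P.-integrable setT f -> Q.-integrable setT (fun w : seqspace T => f (w n)).
Proof.
move=> /integrableP[mf f_fin]; apply/integrableP; split.
  exact: (measurableT_comp mf (measurable_coordinate n)).
rewrite (@ge0_integral_iid_coordinate n (fun x => `|f x|))//.
exact: measurableT_comp.
Qed.

(** The induction peels off coordinate 0 rather than the last one: what remains is the same product
    evaluated at the shifted sequence, which is independent of coordinate 0 and again has law
    [Q]. *)
Lemma ge0_integral_iid_prod (f : T -> \bar R) (t : nat) :
  measurable_fun setT f -> (forall x, 0 <= f x) ->
  \int[Q]_w (\prod_(n < t) f (w n)) = (\int[P]_x f x) ^+ t.
Proof.
move=> mf f0.
have mprod k : measurable_fun setT (fun w : seqspace T => \prod_(n < k) f (w n)).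
  elim: k => [|k ih].
    apply: (eq_measurable_fun (cst 1)); last exact: measurable_cst.
    by move=> w _; rewrite big_ord0.
  apply: (eq_measurable_fun
      (fun w : seqspace T => \prod_(n < k) f (w n) * f (w k))).
    by move=> w _; rewrite big_ord_recr.
  apply: emeasurable_funM => //.
  exact: (measurableT_comp mf (measurable_coordinate k)).
have prod0 k (w : seqspace T) : 0 <= \prod_(n < k) f (w n) by exact: prode_ge0.
elim: t => [|t ih].
  under eq_integral do rewrite big_ord0.
  by rewrite integral_prob_cst.
pose phi (w : seqspace T) := (w 0%N, shift w).
pose F (z : T * seqspace T) := f z.1 * \prod_(n < t) f (z.2 n).
have mphi : measurable_fun setT phi.
  apply: measurable_fun_pair; first exact: measurable_coordinate.
  exact: measurable_shift.
have mF : measurable_fun setT F.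
  apply: emeasurable_funM; first exact: measurableT_comp.
  exact: (measurableT_comp (mprod t)).
have F0 z : 0 <= F z by rewrite mule_ge0.
transitivity (\int[Q]_w F (phi w)).
  by apply: eq_integral => w _; rewrite big_ord_recl.
rewrite -[LHS](@ge0_integral_pushforward _ _ _ _ R _ mphi Q setT F)//.
transitivity (\int[P \x Q]_z F z).
  by apply: eq_measure_integral => A mA _; rewrite /= iid_shift_product.
rewrite fubini_tonelli1// expeS -ih muleC -ge0_integralZl ?integral_ge0//.
apply: eq_integral => x _; rewrite /fubini_F /F/= ge0_integralZl//.
- by rewrite muleC.
- exact: mprod.
- by move=> w _; exact: prod0.
Qed.

End sequence_space_lemmas.

(** * Change of measure *)

Lemma measurable_lne (R : realType) : measurable_fun setT (@lne R).
Proof.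
apply: (eq_measurable_fun (fun x : \bar R =>
   if x == +oo%E then +oo%E
   else if (x <= 0)%E then -oo%E else (ln (fine x))%:E)).
  by move=> [x| |] _ //; rewrite leNye.
apply: measurable_fun_ifT => //=; first exact: measurable_fun_eqe.
apply: measurable_fun_ifT => //=; first exact: measurable_fun_lee.
by apply/measurable_EFinP; apply: measurableT_comp => //; exact: measurable_ln.
Qed.

Lemma measurable_gt0 d (T : measurableType d) (R : realType) (f : T -> R) :
  measurable_fun setT f -> measurable [set x | 0 < f x].
Proof.
move=> mf; have -> : [set x | 0 < f x] = setT `&` f @^-1` `]0, +oo[.
  by rewrite setTI; apply/seteqP; split => x /=; rewrite in_itv/= andbT.
exact: mf.
Qed.

(** The inverse and the power with exponent [-1] are both 0 at 0, so measurability of real powers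
    applies on all of the nonnegative half-line. *)
Lemma measurable_inv_ge0 d (T : measurableType d) (R : realType) (f : T -> R) :
  measurable_fun setT f -> (forall x, 0 <= f x) ->
  measurable_fun setT (fun x => (f x)^-1).
Proof.
move=> mf f0; apply: (eq_measurable_fun (fun x => f x `^ (-1))).
  by move=> x _; rewrite powR_inv1.
exact: (measurableT_comp (@measurable_powR R (-1)) mf).
Qed.

Section likelihood_ratio.
Context d (T : measurableType d) (R : realType).
Variables (P0 P1 : probability T R) (r : T -> R).
Hypothesis P1_ac_P0 : P1 `<< P0.
Hypothesis r_version : is_RN_version P1 P0 r.
Local Open Scope charge_scope.
Local Open Scope ereal_scope.

Let r_ge0 x : (0 <= r x)%R. Proof. by case: r_version. Qed.
Let mr : measurable_fun setT r. Proof. by case: r_version. Qed.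
Let rE : {ae P0, forall x,
  ('d (charge_of_finite_measure P1) '/d P0) x = (r x)%:E}.
Proof. by case: r_version. Qed.
Let mEr : measurable_fun setT (fun x => (r x)%:E).
Proof. exact/measurable_EFinP. Qed.

Lemma ge0_integral_density (f : T -> \bar R) :
  measurable_fun setT f -> (forall x, 0 <= f x) ->
  \int[P1]_x f x = \int[P0]_x (f x * (r x)%:E).
Proof.
move=> mf f0.
rewrite -(Radon_Nikodym_SigmaFinite.change_of_variables P1_ac_P0 f0)//.
have mRN : measurable_fun setT (Radon_Nikodym_SigmaFinite.f P1 P0).
  by apply: measurable_int; exact: Radon_Nikodym_SigmaFinite.f_integrable.
apply: ae_eq_integral => //; [exact: emeasurable_funM..|].
(* Two derivatives meet here: the one of the change-of-variables formula and the one of the charge,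
   of which [r] is a version. They agree [P0]-almost everywhere. *)
apply: ae_eqe_mul2l; apply: ae_eq_trans.
  exact: (ae_eq_Radon_Nikodym_SigmaFinite P1_ac_P0).
by apply: filterS rE => x ->.
Qed.

Lemma integral_ratio : \int[P0]_x (r x)%:E = 1.
Proof.
have := @ge0_integral_density (cst 1) (measurable_cst _) (fun=> lee01).
rewrite integral_prob_cst => ->.
by apply: eq_integral => x _; rewrite mul1e.
Qed.

Let measurable_ratio_gt0 : measurable [set x | (0 < r x)%R].
Proof. exact: measurable_gt0. Qed.

Lemma density_measure (A : set T) : measurable A ->
  P1 A = \int[P0]_x ((\1_A x)%:E * (r x)%:E).
Proof.
move=> mA; rewrite -(@ge0_integral_density (fun x => (\1_A x)%:E)).
- by rewrite integral_indic// setIT.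
- by apply/measurable_EFinP; exact: measurable_indic.
- by move=> x; rewrite lee_fin.
Qed.

Lemma ratio_not_gt0_null : P1 (~` [set x | (0 < r x)%R]) = 0.
Proof.
rewrite density_measure; last exact: measurableC.
apply: integral0_eq => x _; rewrite indicE.
have [xA|_] := boolP (x \in _); last by rewrite mul0e.
suff -> : r x = 0%R by rewrite mule0.
by apply/eqP; rewrite eq_le r_ge0 andbT leNgt; apply/negP; move: xA; rewrite inE.
Qed.

Lemma ratio_gt0_ae : {ae P1, forall x, (0 < r x)%R}.
Proof.
exists (~` [set x | (0 < r x)%R]); split => //; first exact: measurableC.
exact: ratio_not_gt0_null.
Qed.

(** Otherwise absolute continuity would make the set [P1]-null; its complement is [P1]-null as well,
    so [P1] would have mass 0. *)
Lemma ratio_gt0_prob_gt0 : 0 < P0 [set x | (0 < r x)%R].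
Proof.
rewrite lt0e measure_ge0 andbT; apply/eqP => p0.
have p1 : P1 [set x | (0 < r x)%R] = 0.
  exact: (null_content_dominatesP _ _).1 P1_ac_P0 _ measurable_ratio_gt0 p0.
have := probability_setC P1 measurable_ratio_gt0.
by rewrite ratio_not_gt0_null p1 sube0 => /eqP; rewrite eqe eq_sym oner_eq0.
Qed.

(** Under [P0] the integrand becomes [r^-1 * r], which is the indicator of [r > 0] because
    [0^-1 = 0]. *)
Lemma integral_inv_ratio :
  \int[P1]_x ((r x)^-1)%:E = P0 [set x | (0 < r x)%R].
Proof.
rewrite ge0_integral_density; last 2 first.
- by apply/measurable_EFinP; exact: measurable_inv_ge0.
- by move=> x; rewrite lee_fin invr_ge0.
transitivity (\int[P0]_x (\1_[set x | (0 < r x)%R] x)%:E); last first.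
  by rewrite integral_indic// setIT.
apply: eq_integral => x _; rewrite -EFinM indicE.
have [rx|/negP rx] := boolP (x \in [set x | (0 < r x)%R]).
  by move: rx; rewrite inE/= => rx; rewrite mulVf ?gt_eqF.
suff -> : r x = 0%R by rewrite mulr0.
by apply/eqP; rewrite eq_le r_ge0 andbT leNgt; apply/negP; move: rx; rewrite inE.
Qed.

(** A finite reverse divergence forces [P0] to be absolutely continuous with respect to [P1], and
    the set where [r] vanishes is [P1]-null. *)
Lemma ratio_gt0_prob1 : KL P0 P1 < +oo -> P0 [set x | (0 < r x)%R] = 1.
Proof.
rewrite /KL; case: ifPn => [/asboolP P0_ac_P1 _|_]; last by rewrite ltxx.
rewrite -[X in P0 X]setCK probability_setC; last exact: measurableC.
rewrite (_ : P0 _ = 0) ?sube0//.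
apply: ((null_content_dominatesP _ _).1 P0_ac_P1); first exact: measurableC.
exact: ratio_not_gt0_null.
Qed.

Let mlne_ratio : measurable_fun setT (fun x => lne (r x)%:E).
Proof. exact: (measurableT_comp (@measurable_lne R) mEr). Qed.

Lemma KL_ratio : KL P1 P0 = \int[P1]_x lne (r x)%:E.
Proof.
rewrite /KL; case: ifPn => [_|/asboolP//].
apply: ae_eq_integral => //.
- apply: (measurableT_comp (@measurable_lne R)).
  apply: (measurable_int P0); apply: Radon_Nikodym_integrable; exact: P1_ac_P0.
have [N [mN N0 subN]] := rE; exists N; split => //.
  exact: ((null_content_dominatesP _ _).1 P1_ac_P0 _ mN N0).
by move=> x /= H; apply: subN => /= E; apply: H => _; rewrite E.
Qed.

Lemma integrable_log_ratio : KL P1 P0 < +oo ->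
  P1.-integrable setT (fun x => lne (r x)%:E).
Proof.
rewrite KL_ratio => KLfin; apply/integrableP; split => //.
pose f x := lne (r x)%:E.
have negfin : \int[P1]_x f^\- x < +oo.
  rewrite ge0_integral_density//; last exact: measurable_funeneg.
  apply: (@le_lt_trans _ _ (\int[P0]_x 1)); last first.
    by rewrite integral_prob_cst ltry.
  apply: ge0_le_integral => //.
  - by move=> x _; rewrite mule_ge0// lee_fin.
  - by apply: emeasurable_funM => //; exact: measurable_funeneg.
  move=> x _; have := r_ge0 x; rewrite le_eqVlt => /predU1P[<-|rx].
    by rewrite mule0.
  rewrite funenegE /f lne_EFin// -EFinN -EFin_max -EFinM lee_fin.
  rewrite maxEle; case: ifPn => [_|]; first by rewrite mul0r.
  rewrite -ltNge => lnr.
  (* Multiplied by [r], this gives [r * (- ln r) <= 1 - r <= 1], which bounds the integral of the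
     negative part by 1. *)
  have : (ln (r x)^-1 <= (r x)^-1 - 1)%R.
    have -> : ln (r x)^-1 = ln (1 + ((r x)^-1 - 1)) by congr ln; lra.
    by apply: le_ln1Dx; have := rx; rewrite -invr_gt0; lra.
  rewrite lnV ?posrE// => le_inv.
  have := ler_wpM2l (ltW rx) le_inv.
  by rewrite mulrBr mulfV ?gt_eqF// mulr1 mulrC => /le_trans; apply; lra.
rewrite -/f in KLfin *.
rewrite [ltLHS](_ : _ = \int[P1]_x f^\+ x + \int[P1]_x f^\- x); last first.
  rewrite -ge0_integralD//; last 2 first.
  - exact: measurable_funepos.
  - exact: measurable_funeneg.
  by apply: eq_integral => x _; rewrite -[LHS]/((abse \o f) x) fune_abse.
rewrite lte_add_pinfty//.
(* The divergence is the difference of the integrals of the two parts. Since the negative one is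
   finite, an infinite positive one would make the divergence infinite. *)
move: KLfin; rewrite integralE.
have : 0 <= \int[P1]_x f^\- x by exact: integral_ge0.
case: (\int[P1]_x f^\- x) negfin => //= y _ _.
by case: (\int[P1]_x f^\+ x) => //= z _; rewrite ltry.
Qed.

End likelihood_ratio.

(** * The statistic and its threshold *)

Lemma lne_cases (R : realType) (x : R) :
  lne x%:E = -oo%E \/ exists c : R, lne x%:E = c%:E.
Proof. by rewrite /lne; case: ifP => _; [left|right; exists (ln x)]. Qed.

Lemma lneM_ge0 (R : realType) (x y : R) : 0 <= x -> 0 <= y ->
  lne (x * y)%:E = (lne x%:E + lne y%:E)%E.
Proof.
rewrite le_eqVlt => /predU1P[<- y0|x0].
  by rewrite mul0r le0_lneNy// addNye//; rewrite /lne; case: ifP.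
rewrite le_eqVlt => /predU1P[<-|y0].
  by rewrite mulr0 [X in (_ + X)%E]le0_lneNy// le0_lneNy// addeNy.
by rewrite !lne_EFin ?mulr_gt0// lnM// posrE.
Qed.

(** Candidate times are integers: without a hit up to [t], the infimum is at least [t.+1], and it is
    [+oo] when there is no hit at all. *)
Lemma first_time_gtP d (T : measurableType d) (R : realType)
    (S : nat -> set (seqspace T)) (w : seqspace T) (t : nat) :
  (t%:R%:E < first_time R S w)%E <-> forall n, (n <= t)%N -> ~ S n w.
Proof.
split=> [tS n nt Sn|noS].
  have : (first_time R S w <= n%:R%:E)%E by apply: ereal_inf_lbound; exists n.
  by move=> /(lt_le_trans tS); rewrite lte_fin ltr_nat ltnNge nt.
apply: (@lt_le_trans _ _ t.+1%:R%:E); first by rewrite lte_fin ltr_nat.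
apply: le_ereal_inf_tmp => _ [n Sn <-]; rewrite lee_fin ler_nat ltnNge.
by apply/negP => /noS; exact.
Qed.

Section pointwise.
Context d (T : measurableType d) (R : realType).
Variables (P0 : probability T R) (r : T -> R) (b : R).
Hypothesis r_ge0 : forall x, 0 <= r x.
Hypothesis b_gt0 : 0 < b.
Hypothesis Z_gt0 : 0 < fine (Z P0 r b).
Implicit Types (w : seqspace T) (t : nat).

Lemma Rpow_ge0 x : 0 <= Rpow P0 r b x.
Proof. by rewrite divr_ge0 ?powR_ge0// ltW. Qed.

Lemma W_ge0 t w : 0 <= W P0 r b t w.
Proof. by apply: prodr_ge0 => n _; exact: Rpow_ge0. Qed.

Lemma lne_Rpow x :
  lne (Rpow P0 r b x)%:E = (b%:E * lne (r x)%:E - (ln (fine (Z P0 r b)))%:E)%E.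
Proof.
rewrite /Rpow; have := r_ge0 x; rewrite le_eqVlt => /predU1P[<-|rx].
  by rewrite powR0 ?gt_eqF// mul0r le0_lneNy// gt0_muleNy ?lte_fin// addNye.
by rewrite !lne_EFin ?divr_gt0 ?powR_gt0// ln_div ?posrE ?powR_gt0// ln_powR.
Qed.

Lemma G0 w : G r 0 w = 0%E.
Proof. by rewrite /G big_ord0. Qed.

Lemma GS t w : G r t.+1 w = (G r t w + lne (r (w t))%:E)%E.
Proof. by rewrite /G big_ord_recr. Qed.

(** Since [+oo] never occurs, extended-real identities about [G] reduce to a check at [-oo] and real
    algebra. *)
Lemma G_cases t w : G r t w = -oo%E \/ exists g : R, G r t w = g%:E.
Proof.
elim: t => [|t IH]; first by right; exists 0; rewrite G0.
rewrite GS; case: IH => [->|[g ->]]; first by left; rewrite addNye.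
have [->|[c ->]] := lne_cases (r (w t)); first by left; rewrite addeNy.
by right; exists (g + c).
Qed.

Lemma lne_W_sum t w :
  lne (W P0 r b t w)%:E
    = (b%:E * G r t w - (t%:R * ln (fine (Z P0 r b)))%:E)%E.
Proof.
elim: t => [|t IH].
  by rewrite /W /iid_product G0 big_ord0 lne_EFin// ln1 mule0 mul0r sube0.
have -> : W P0 r b t.+1 w = W P0 r b t w * Rpow P0 r b (w t).
  by rewrite /W /iid_product big_ord_recr.
rewrite lneM_ge0 ?W_ge0 ?Rpow_ge0// IH lne_Rpow GS.
case: (G_cases t w) => [->|[g ->]].
  by rewrite !addNye !gt0_muleNy ?lte_fin// !addNye.
have [->|[c ->]] := lne_cases (r (w t)).
  by rewrite addeNy !gt0_muleNy ?lte_fin// !addNye addeNy.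
by rewrite -!EFinM -!EFinN -!EFinD -?EFinM -?EFinD -natr1; congr EFin; ring.
Qed.

Lemma lne_W alpha t w :
  lne (W P0 r b t w)%:E = (b%:E * (G r t w - (threshold P0 r alpha b t)%:E)
                             + (ln alpha^-1)%:E)%E.
Proof.
rewrite lne_W_sum; case: (G_cases t w) => [->|[g ->]].
  by rewrite !addNye gt0_muleNy ?lte_fin// !addNye.
rewrite -!EFinM -!EFinN -!EFinD -?EFinM -?EFinD; congr EFin.
by rewrite /threshold /lambda; field; rewrite gt_eqF.
Qed.

(** Take logarithms, monotone on the nonnegative extended half-line, and insert the affine identity
    [lne_W]; the slope [b > 0] keeps the direction. If [G] is [-oo], then the logarithm of [W] is
    [-oo] too and both inequalities hold. *)
Lemma W_le_threshold alpha t w : 0 < alpha ->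
  (W P0 r b t w <= alpha^-1) = (G r t w <= (threshold P0 r alpha b t)%:E)%E.
Proof.
move=> a0.
have mem (x : R) : 0 <= x -> x%:E \in `[0%E, +oo%E].
  by move=> x0; rewrite in_itv/= lee_fin x0 leey.
rewrite -lee_fin -(lee_lne (mem _ (W_ge0 t w)) (mem alpha^-1 _)); last first.
  by rewrite invr_ge0 ltW.
rewrite (lne_W alpha) [X in (_ <= X)%E]lne_EFin ?invr_gt0//.
case: (G_cases t w) => [->|[g ->]].
  by rewrite addNye gt0_muleNy ?lte_fin// addNye !leNye.
rewrite -EFinN -EFinD -?EFinM -?EFinD !lee_fin gerDr pmulr_rle0//.
by rewrite subr_le0.
Qed.

Lemma rejection_llr alpha t : 0 < alpha ->
  rejection alpha (W P0 r b) t = llr_rejection r (threshold P0 r alpha b) t.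
Proof.
move=> a0; apply/seteqP; split => w; rewrite /rejection /llr_rejection/=;
  by rewrite !ltNge W_le_threshold.
Qed.

End pointwise.

(** * Chernoff bound for product tests *)

Section negative_power.
Context (R : realType).
Local Open Scope ereal_scope.
Implicit Types x y s : R.

Lemma npowR_gt0 x s : (0 <= x)%R -> 0 < npowR x s.
Proof.
move=> x0; rewrite /npowR; case: ifPn => [//|xn0].
by rewrite lte_fin powR_gt0// lt_neqAle eq_sym xn0.
Qed.

(** Both factors on the right are positive, so the [+oo] produced by a zero base never meets a
    factor 0. *)
Lemma npowRM x y s : (0 <= x)%R -> (0 <= y)%R ->
  npowR (x * y) s = npowR x s * npowR y s.
Proof.
move=> x0 y0; rewrite [in LHS]/npowR mulf_eq0.
have [->|xn0] := eqVneq x 0%R; rewrite /=.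
  by rewrite {1}/npowR eqxx gt0_mulye// npowR_gt0.
have [->|yn0] := eqVneq y 0%R; rewrite /=.
  by rewrite [X in _ * X]/npowR eqxx gt0_muley// npowR_gt0.
by rewrite /npowR (negbTE xn0) (negbTE yn0) powRM// EFinM.
Qed.

Lemma npowR_le x y s : (0 <= s)%R -> (0 <= x)%R -> (0 < y)%R -> (x <= y)%R ->
  (y `^ (- s))%:E <= npowR x s.
Proof.
move=> s0 x0 y0 xy; rewrite /npowR; case: ifPn => [_|xn0]; first by rewrite leey.
have xgt0 : (0 < x)%R by rewrite lt_neqAle eq_sym xn0.
rewrite lee_fin !powRN lef_pV2 ?posrE ?powR_gt0//.
by rewrite ge0_ler_powR// nnegrE ltW.
Qed.

Lemma measurable_npowR s : measurable_fun setT (@npowR R ^~ s).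
Proof.
have meq : measurable_fun setT (fun x : R => x == 0%R).
  have mid : measurable_fun setT (fun x : R => x) by exact: measurable_id.
  have m0 : measurable_fun setT (fun x : R => 0%R : R) by exact: measurable_cst.
  exact: (measurable_fun_eqr mid m0).
have mpow : measurable_fun setT (fun x : R => (x `^ (- s))%:E).
  by apply/measurable_EFinP; exact: (@measurable_powR R (- s)%R).
exact: (measurable_fun_ifT meq (measurable_cst _) mpow).
Qed.

End negative_power.

Section chernoff.
Context d (T : measurableType d) (R : realType).
Variables (P : probability T R) (Q : probability (seqspace T) R).
Hypothesis Q_iid : is_iid_law P Q.
Variable E : T -> R.
Hypotheses (E_ge0 : forall x, (0 <= E x)%R) (mE : measurable_fun setT E).
Local Open Scope ereal_scope.

Lemma npowR_iid_product s t (w : seqspace T) :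
  npowR (iid_product E t w) s = \prod_(n < t) npowR (E (w n)) s.
Proof.
elim: t => [|t IH].
  by rewrite /iid_product !big_ord0 /npowR oner_eq0 powR1.
rewrite big_ord_recr -IH /iid_product big_ord_recr npowRM//.
by apply: prodr_ge0 => n _; exact: E_ge0.
Qed.

Lemma measurable_iid_product t : measurable_fun setT (iid_product E t).
Proof.
apply: measurable_prod => n _.
exact: (measurableT_comp mE (measurable_coordinate n)).
Qed.

(** Markov's inequality for the power [-s] of the product: on the acceptance event this power is at
    least that of [alpha^-1], so the indicator is dominated. The expectation of the power then
    factorises over the coordinates. *)
Lemma type2_le_chernoff (alpha s : R) t : (0 < alpha)%R -> (0 <= s)%R ->
  type2 Q alpha (iid_product E) t
    <= ((alpha^-1) `^ s)%:E * (\int[P]_x npowR (E x) s) ^+ t.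
Proof.
move=> a0 s0; rewrite /type2; set A := [set w | _].
have mW := measurable_iid_product t.
have mN := measurableT_comp (@measurable_npowR R s) mE.
have mA : measurable A.
  have -> : A = setT `&` iid_product E t @^-1` `]-oo, (alpha^-1)%R].
    by rewrite setTI; apply/seteqP; split => w; rewrite /A /= in_itv.
  exact: mW.
have N0 x : 0 <= npowR (E x) s by rewrite ltW// npowR_gt0.
have -> : Q A = \int[Q]_w (\1_A w)%:E by rewrite integral_indic// setIT.
rewrite -(ge0_integral_iid_prod Q_iid)// -ge0_integralZl//; last 3 first.
- apply: (eq_measurable_fun (fun w : seqspace T => npowR (iid_product E t w) s)).
    by move=> w _; rewrite npowR_iid_product.
  exact: (measurableT_comp (@measurable_npowR R s) mW).
- by move=> w _; exact: prode_ge0.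
- by rewrite lee_fin powR_ge0.
have mR : measurable_fun setT (fun w : seqspace T =>
    ((alpha^-1) `^ s)%:E * \prod_(n < t) npowR (E (w n)) s).
  apply: (eq_measurable_fun (fun w : seqspace T =>
      ((alpha^-1) `^ s)%:E * npowR (iid_product E t w) s)).
    by move=> w _; rewrite npowR_iid_product.
  apply: emeasurable_funM => //.
  exact: (measurableT_comp (@measurable_npowR R s) mW).
apply: ge0_le_integral => //.
- by apply/measurable_EFinP; exact: measurable_indic.
move=> w _; rewrite indicE; have [wA|_] := boolP (w \in A); last first.
  by rewrite mule_ge0 ?lee_fin ?powR_ge0//; apply: prode_ge0.
rewrite -npowR_iid_product; move: wA; rewrite inE => wA.
have := @npowR_le _ (iid_product E t w) alpha^-1 s s0.
rewrite invr_gt0 prodr_ge0// => /(_ isT a0 wA).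
rewrite -(@lee_pmul2l _ ((alpha^-1) `^ s)%:E)//; last first.
  by rewrite lte_fin powR_gt0// invr_gt0.
by rewrite -EFinM powRN mulfV// gt_eqF// powR_gt0// invr_gt0.
Qed.

End chernoff.

(** * The power family *)

Section power_family_integrals.
Context d (T : measurableType d) (R : realType).
Variables (P0 P1 : probability T R) (r : T -> R) (b : R).
Hypothesis P1_ac_P0 : P1 `<< P0.
Hypothesis r_version : is_RN_version P1 P0 r.
Hypotheses (b_gt0 : 0 < b) (Z_fin : (Z P0 r b < +oo)%E).
Local Open Scope ereal_scope.

Let r_ge0 x : (0 <= r x)%R. Proof. by case: r_version. Qed.
Let mr : measurable_fun setT r. Proof. by case: r_version. Qed.
Let mEr : measurable_fun setT (fun x => (r x)%:E).
Proof. exact/measurable_EFinP. Qed.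
Let mrb : measurable_fun setT (fun x => (r x `^ b)%:E).
Proof.
by apply/measurable_EFinP; exact: (measurableT_comp (@measurable_powR R b) mr).
Qed.

Lemma Z_ge0 : 0 <= Z P0 r b.
Proof. by apply: integral_ge0 => x _; rewrite lee_fin powR_ge0. Qed.

Lemma fine_ZK : (fine (Z P0 r b))%:E = Z P0 r b.
Proof. by rewrite fineK// ge0_fin_numE// Z_ge0. Qed.

(** If the integral were 0, its nonnegative integrand, and hence [r], would vanish [P0]-almost
    everywhere, against [ratio_gt0_prob_gt0]. *)
Lemma fine_Z_gt0 : (0 < fine (Z P0 r b))%R.
Proof.
rewrite -lte_fin fine_ZK lt0e Z_ge0 andbT; apply/eqP => Z0.
have : ae_eq P0 setT (fun x => (r x `^ b)%:E) (cst 0).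
  apply/(ae_eq_integral_abs P0 measurableT mrb).
  rewrite -[RHS]Z0; apply: eq_integral => x _.
  by rewrite gee0_abs// lee_fin powR_ge0.
case=> N [mN N0 subN].
have := ratio_gt0_prob_gt0 P1_ac_P0 r_version; rewrite ltNge => /negP; apply.
rewrite -N0; apply: le_measure; rewrite ?inE//.
  exact: measurable_gt0.
move=> x /= rx; apply: subN => /= /(_ I) /eqP.
by rewrite eqe gt_eqF// powR_gt0.
Qed.

Lemma measurable_Rpow : measurable_fun setT (Rpow P0 r b).
Proof.
apply: measurable_funM; last exact: measurable_cst.
exact: (measurableT_comp (@measurable_powR R b) mr).
Qed.

Lemma c_coefE : KL P1 P0 < +oo ->
  c_coef P0 r P1 b = b%:E * KL P1 P0 - (ln (fine (Z P0 r b)))%:E.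
Proof.
move=> KLfin; have int := integrable_log_ratio P1_ac_P0 r_version KLfin.
have intb : P1.-integrable setT (fun x => b%:E * lne (r x)%:E).
  exact: integrableZl.
rewrite /c_coef (eq_integral (fun x =>
    b%:E * lne (r x)%:E - cst (ln (fine (Z P0 r b)))%:E x)); last first.
  by move=> x _; rewrite lne_Rpow//; exact: fine_Z_gt0.
rewrite integralB//; last exact: finite_measure_integrable_cst.
by rewrite integralZl// integral_prob_cst (KL_ratio P1_ac_P0 r_version).
Qed.

(** The exponent [b^-1] undoes the power [b]: where [r > 0] the integrand is a constant times
    [r^-1]. The two integrands differ where [r = 0], one being [+oo] and the other 0, but that set
    is [P1]-null. *)
Lemma integral_npowR_Rpow :
  \int[P1]_x npowR (Rpow P0 r b x) b^-1 =
  (fine (Z P0 r b) `^ b^-1)%:E * P0 [set x | (0 < r x)%R].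
Proof.
have Z0 := fine_Z_gt0.
have minv : measurable_fun setT (fun x => ((r x)^-1)%:E).
  by apply/measurable_EFinP; exact: measurable_inv_ge0.
rewrite -(integral_inv_ratio P1_ac_P0 r_version).
rewrite -ge0_integralZl_EFin ?powR_ge0//; last first.
  by move=> x _; rewrite lee_fin invr_ge0.
apply: ge0_ae_eq_integral => //.
- exact: (measurableT_comp (@measurable_npowR R b^-1) measurable_Rpow).
- by apply: emeasurable_funM.
- by move=> x _; rewrite ltW// npowR_gt0// Rpow_ge0.
- by move=> x _; rewrite -EFinM lee_fin mulr_ge0 ?powR_ge0// invr_ge0.
apply: filterS (ratio_gt0_ae P1_ac_P0 r_version) => x rx _.
have rb : (0 < r x `^ b)%R by rewrite powR_gt0.
rewrite /npowR /Rpow gt_eqF ?divr_gt0// -EFinM; congr EFin.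
rewrite powRM ?ltW ?invr_gt0// -powRrM mulrN mulfV ?gt_eqF//.
rewrite powR_inv1// mulrC; congr (_ * _)%R.
by rewrite -powR_inv1 ?ltW// -powRrM mulrN mulN1r opprK.
Qed.

End power_family_integrals.

(** * The sign of the exponent [lambda], by comparing [Z] with 1 *)

Section exponent_sign.
Context d (T : measurableType d) (R : realType).
Variables (P0 P1 : probability T R) (r : T -> R) (b : R).
Hypothesis P1_ac_P0 : P1 `<< P0.
Hypothesis r_version : is_RN_version P1 P0 r.
Hypotheses (b_gt0 : 0 < b) (Z_fin : (Z P0 r b < +oo)%E).
Local Open Scope ereal_scope.

Let r_ge0 x : (0 <= r x)%R. Proof. by case: r_version. Qed.
Let mr : measurable_fun setT r. Proof. by case: r_version. Qed.
Let mrb : measurable_fun setT (fun x => r x `^ b)%R.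
Proof. exact: (measurableT_comp (@measurable_powR R b) mr). Qed.

Lemma lambda_gt0 : (0 < lambda P0 r b)%R = (fine (Z P0 r b) < 1)%R.
Proof.
have Z0 := fine_Z_gt0 P1_ac_P0 r_version Z_fin.
rewrite /lambda mulNr oppr_gt0 pmulr_rlt0 ?invr_gt0//.
by rewrite -[in RHS]ltr_ln ?posrE// ln1.
Qed.

(* [r ^ b] is compared with its tangent [1 + b (r - 1)] after adding [b] to
   both, so that both integrands are nonnegative. *)
Let integral_powRD : \int[P0]_x (r x `^ b + b)%:E = Z P0 r b + b%:E.
Proof.
under eq_integral do rewrite EFinD.
rewrite ge0_integralD//.
- by rewrite integral_prob_cst.
- by move=> x _; rewrite lee_fin powR_ge0.
- exact/measurable_EFinP.
- by move=> x _; rewrite lee_fin ltW.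
Qed.

Let integral_tangent : \int[P0]_x (1 + b * r x)%:E = (1 + b)%:E.
Proof.
under eq_integral do rewrite EFinD EFinM.
rewrite ge0_integralD//.
- rewrite integral_prob_cst ge0_integralZl_EFin ?ltW//; last 2 first.
  + by move=> x _; rewrite lee_fin.
  + exact/measurable_EFinP.
  by rewrite (integral_ratio P1_ac_P0 r_version) mule1.
- by move=> x _; rewrite -EFinM lee_fin mulr_ge0// ltW.
- by apply: emeasurable_funM => //; exact/measurable_EFinP.
Qed.

Let mtangent : measurable_fun setT (fun x => (1 + b * r x)%:E).
Proof.
by apply/measurable_EFinP; apply: measurable_funD => //; exact: measurable_funM.
Qed.

Let mpowRD : measurable_fun setT (fun x => (r x `^ b + b)%:E).
Proof. by apply/measurable_EFinP; exact: measurable_funD. Qed.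

Let tangent_ge0 x : 0 <= (1 + b * r x)%:E.
Proof. by rewrite lee_fin addr_ge0// mulr_ge0// ltW. Qed.

Let powRD_ge0 x : 0 <= (r x `^ b + b)%:E.
Proof. by rewrite lee_fin addr_ge0 ?powR_ge0// ltW. Qed.

(** For [b >= 1] the power lies above its tangent at 1, and the tangent has [P0]-mean 1 because [r]
    does. *)
Lemma Z_ge1 : (1 <= b)%R -> (1 <= fine (Z P0 r b))%R.
Proof.
move=> b1; have : (1 + b)%:E <= Z P0 r b + b%:E.
  rewrite -integral_tangent -integral_powRD; apply: ge0_le_integral => //.
  by move=> x _; rewrite lee_fin; have := powR_tangent_ge (r_ge0 x) b1; lra.
by rewrite -(fine_ZK Z_fin) -EFinD lee_fin; lra.
Qed.

(** The gap [h] between tangent and power is nonnegative with [P0]-mean [1 - Z]. If [Z >= 1], the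
    gap vanishes almost everywhere, strictness of the tangent inequality forces [r = 1] almost
    everywhere, and the two measures coincide. *)
Lemma Z_lt1 : (b < 1)%R ->
  (exists2 A : set T, measurable A & P0 A <> P1 A) -> (fine (Z P0 r b) < 1)%R.
Proof.
move=> b1 [A mA P01A].
pose h x := (1 + b * r x - (r x `^ b + b))%R.
have b01 : (0 < b <= 1)%R by rewrite b_gt0 ltW.
have h0 x : 0 <= (h x)%:E.
  by rewrite lee_fin /h; have := powR_tangent_le (r_ge0 x) b01; lra.
have mh : measurable_fun setT (fun x => (h x)%:E).
  by apply/measurable_EFinP; apply: measurable_funB; exact/measurable_EFinP.
have sum_h : \int[P0]_x (h x)%:E + (Z P0 r b + b%:E) = (1 + b)%:E.
  rewrite -integral_powRD -integral_tangent -ge0_integralD//.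
  by apply: eq_integral => x _; rewrite -EFinD /h subrK.
have h_int_ge0 : 0 <= \int[P0]_x (h x)%:E by exact: integral_ge0.
rewrite ltNge; apply/negP => Z1; apply: P01A.
have h_int0 : \int[P0]_x (h x)%:E = 0.
  apply/eqP; rewrite eq_le h_int_ge0 andbT.
  move: sum_h; rewrite -(fine_ZK Z_fin) -EFinD.
  case: (\int[P0]_x (h x)%:E) => //= y [] y_eq.
  by rewrite lee_fin; lra.
have : ae_eq P0 setT (fun x => (h x)%:E) (cst 0).
  apply/(ae_eq_integral_abs P0 measurableT mh).
  by rewrite -[RHS]h_int0; apply: eq_integral => x _; rewrite gee0_abs.
move=> h_ae; rewrite (density_measure P1_ac_P0 r_version mA).
have -> : P0 A = \int[P0]_x (\1_A x)%:E by rewrite integral_indic// setIT.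
have mind : measurable_fun setT (fun x => (\1_A x : R)%:E).
  by apply/measurable_EFinP; exact: measurable_indic.
apply: ae_eq_integral => //.
  by apply: emeasurable_funM => //; exact/measurable_EFinP.
apply: filterS h_ae => x /(_ I) [] hx _.
suff -> : r x = 1%R by rewrite mule1.
apply/eqP/negPn/negP => rx1.
have b01' : (0 < b < 1)%R by rewrite b_gt0.
by have := powR_tangent_lt (r_ge0 x) rx1 b01'; move: hx; rewrite /h; lra.
Qed.

End exponent_sign.

(** * Mean and measurability of the log-likelihood-ratio sum *)

Section iid_llr.
Context d (T : measurableType d) (R : realType).
Variables (P0 P1 : probability T R) (Q1 : probability (seqspace T) R).
Variables (r : T -> R).
Hypothesis P1_ac_P0 : P1 `<< P0.
Hypothesis r_version : is_RN_version P1 P0 r.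
Hypothesis Q1_iid : is_iid_law P1 Q1.
Hypothesis KL_fin : (KL P1 P0 < +oo)%E.
Local Open Scope ereal_scope.

Let mlne_ratio : measurable_fun setT (fun x => lne (r x)%:E).
Proof.
apply: (measurableT_comp (@measurable_lne R)).
by apply/measurable_EFinP; case: r_version.
Qed.

Lemma KL_fin_num : KL P1 P0 \is a fin_num.
Proof.
rewrite (KL_ratio P1_ac_P0 r_version).
apply: integrable_fin_num => //.
exact: (integrable_log_ratio P1_ac_P0 r_version).
Qed.

Lemma measurable_G t : measurable_fun setT (G r t).
Proof.
apply: emeasurable_sum => n.
exact: (measurableT_comp mlne_ratio (measurable_coordinate n)).
Qed.

Lemma integral_G t : \int[Q1]_w G r t w = t%:R%:E * KL P1 P0.
Proof.
have int := integrable_log_ratio P1_ac_P0 r_version KL_fin.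
rewrite /G (integral_sum measurableT
  (fun n : 'I_t => integrable_iid_coordinate Q1_iid n int)).
under eq_bigr do rewrite (integral_iid_coordinate Q1_iid _ mlne_ratio)
  -(KL_ratio P1_ac_P0 r_version).
have [k ->] : exists k, KL P1 P0 = k%:E.
  by exists (fine (KL P1 P0)); rewrite fineK// KL_fin_num.
by rewrite sumEFin sumr_const card_ord -EFinM mulr_natl.
Qed.

Lemma measurable_G_le t c : measurable [set w | G r t w <= c].
Proof.
have -> : [set w | G r t w <= c] = setT `&` G r t @^-1` `]-oo, c].
  by rewrite setTI; apply/seteqP; split => w; rewrite /= in_itv.
apply: (measurable_G t measurableT); exact: emeasurable_itv.
Qed.

End iid_llr.

(** * The Chernoff bound of the power family at [s = 1 / b] *)

Section chernoff_power.
Context d (T : measurableType d) (R : realType).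
Variables (P0 P1 : probability T R) (r : T -> R) (b : R).
Hypothesis P1_ac_P0 : P1 `<< P0.
Hypothesis r_version : is_RN_version P1 P0 r.
Hypotheses (b_gt0 : 0 < b) (Z_fin : (Z P0 r b < +oo)%E).
Variable alpha : R.
Hypothesis alpha_gt0 : 0 < alpha.
Local Open Scope ereal_scope.

Let p := P0 [set x | (0 < r x)%R].

Let p_fin_num : p \is a fin_num.
Proof. by rewrite fin_num_measure//; apply: measurable_gt0; case: r_version. Qed.

(** In the exponent, the power of [alpha^-1] contributes [ln alpha^-1 / b] and the [t] factors of
    [Z] contribute [- t * lambda]; together they form the threshold, and [p ^+ t] is left over. *)
Lemma chernoff_power_factor t :
  ((alpha^-1) `^ b^-1)%:E * (\int[P1]_x npowR (Rpow P0 r b x) b^-1) ^+ t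
  = (expR (threshold P0 r alpha b t))%:E * p ^+ t.
Proof.
have Z0 := fine_Z_gt0 P1_ac_P0 r_version Z_fin.
rewrite (integral_npowR_Rpow P1_ac_P0 r_version)// -/p.
have [q ->] : exists q, p = q%:E.
  by exists (fine p); rewrite fineK// p_fin_num.
rewrite -EFinM -!EFin_expe -!EFinM; congr EFin.
rewrite exprMn mulrA; congr (_ * _)%R.
have powE (x : R) : (0 < x)%R -> (x `^ b^-1 = expR (b^-1 * ln x))%R.
  by move=> x0; rewrite /powR gt_eqF.
rewrite !powE ?invr_gt0// -expRM_natl -expRD; congr expR.
by rewrite /threshold /lambda; ring.
Qed.

Lemma chernoff_boundE t :
  chernoff_bound P1 alpha b^-1 (Rpow P0 r b) t
  = (expR (threshold P0 r alpha b t))%:E * p ^+ t.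
Proof.
rewrite -chernoff_power_factor /chernoff_bound /Lambda.
have Z0 := fine_Z_gt0 P1_ac_P0 r_version Z_fin.
set I := \int[P1]_x _.
(* The integral is a positive real because [Z] and [p] are, so its logarithm is finite and the
   exponential inverts it in real arithmetic. *)
have [y y0 ->] : exists2 y, (0 < y)%R & I = y%:E.
  have := ratio_gt0_prob_gt0 P1_ac_P0 r_version.
  rewrite /I (integral_npowR_Rpow P1_ac_P0 r_version)// -/p.
  have [q ->] : exists q, p = q%:E.
    by exists (fine p); rewrite fineK// p_fin_num.
  rewrite lte_fin => q0; exists (fine (Z P0 r b) `^ b^-1 * q)%R => //.
  by rewrite mulr_gt0// powR_gt0.
rewrite lne_EFin// muleN oppeK -EFinM -EFinD -EFin_expe -EFinM /=; congr EFin.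
by rewrite expRD expRM_natl lnK ?posrE// /powR gt_eqF// invr_gt0.
Qed.

End chernoff_power.

Theorem proposition5p5 (d : measure_display) (T : measurableType d)
  (R : realType) (P0 P1 : probability T R)
  (Q1 : probability (seqspace T) R) (r : T -> R) (alpha beta : R)
  (P1_ac_P0 : P1 `<< P0) (KL_fin : (KL P1 P0 < +oo)%E)
  (r_version : is_RN_version P1 P0 r)
  (Q1_iid : is_iid_law P1 Q1)
  (beta_gt0 : 0 < beta) (Z_fin : (Z P0 r beta < +oo)%E)
  (alpha_gt0 : 0 < alpha) (alpha_lt1 : alpha < 1) :
  let l := ln alpha^-1 in
  let lam := lambda P0 r beta in
  let B := threshold P0 r alpha beta in
  let Wb := W P0 r beta in
  let Gs := G r in
  let gamma := type2 Q1 alpha Wb in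
  let gammabar := seq_type2 Q1 alpha Wb in
  let chernoff := chernoff_bound P1 alpha beta^-1 (Rpow P0 r beta) in
  (* (a) *)
  (forall t : nat,
    [/\ forall w : seqspace T,
          lne (Wb t w)%:E = (beta%:E * (Gs t w - (B t)%:E) + l%:E)%E,
        gamma t = Q1 [set w | (Gs t w <= (B t)%:E)%E] &
        gammabar t = Q1 [set w | forall n : nat, (1 <= n <= t)%N ->
                                   (Gs n w <= (B n)%:E)%E]])
  /\
  (* (b) *)
  (forall b : R, 0 < b -> (Z P0 r b < +oo)%E ->
    (forall t : nat, rejection alpha (W P0 r b) t
                     = llr_rejection r (threshold P0 r alpha b) t)
    /\ (forall w : seqspace T,
          stopping_time alpha (W P0 r b) w
          = first_time R (llr_rejection r (threshold P0 r alpha b)) w))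
  /\
  (* (c) *)
  (forall t : nat,
    [/\ (\int[Q1]_w Gs t w = t%:R%:E * KL P1 P0)%E,
        (t%:R%:E * c_coef P0 r P1 beta <= l%:E)%E ->
          (Q1 [set w | (Gs t w <= \int[Q1]_v Gs t v)%E] <= gamma t)%E &
        (c_coef P0 r P1 beta <= 0)%E ->
          (Q1 [set w | (Gs t w <= \int[Q1]_v Gs t v)%E] <= gamma t)%E])
  /\
  (forall t : nat,
    (gamma t <= (expR (B t))%:E)%E
    /\ (~ (0 < lam /\ l / (beta * lam) < t%:R) -> 1 <= expR (B t)))
  /\
  ((0 < lam -> beta < 1)
   /\ ((exists2 A : set T, measurable A & P0 A <> P1 A) ->
         (0 < lam <-> beta < 1)))
  /\
  (forall t : nat,
    [/\ (gamma t <= chernoff t)%E,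
        (chernoff t = (expR (B t))%:E * P0 [set x | (0 < r x)%R] ^+ t)%E,
        (0 < t)%N -> (P0 [set x | (0 < r x)%R] < 1)%E ->
          (chernoff t < (expR (B t))%:E)%E &
        (KL P0 P1 < +oo)%E -> chernoff t = (expR (B t))%:E]).
Proof.
move=> l lam B Wb Gs gamma gammabar chernoff.
have r_ge0 : forall x, 0 <= r x by case: r_version.
have mr : measurable_fun setT r by case: r_version.
have Zpos := fine_Z_gt0 P1_ac_P0 r_version Z_fin.
have l_gt0 : 0 < l by rewrite ln_gt0// invf_gt1.
have pE : exists2 q, 0 <= q <= 1 & P0 [set x | 0 < r x] = q%:E.
  have mp := measurable_gt0 mr.
  exists (fine (P0 [set x | 0 < r x])); last by rewrite fineK// fin_num_measure.
  by rewrite fine_ge0//= -lee_fin fineK ?fin_num_measure// probability_le1.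
have gammaE t : gamma t = Q1 [set w | (Gs t w <= (B t)%:E)%E].
  rewrite /gamma /type2; congr (Q1 _); apply/seteqP; split => w /=;
    by rewrite W_le_threshold.
have chernoffE t :
    chernoff t = ((expR (B t))%:E * P0 [set x | (0 < r x)%R] ^+ t)%E.
  exact: (chernoff_boundE P1_ac_P0).
have gamma_chernoff t : (gamma t <= chernoff t)%E.
  rewrite chernoffE -(chernoff_power_factor P1_ac_P0)//.
  apply: (type2_le_chernoff Q1_iid) => //.
  - by move=> x; exact: Rpow_ge0.
  - exact: measurable_Rpow r_version.
  - by rewrite invr_ge0 ltW.
(* The surrogate bound drops the factor [P0 (r > 0) ^ t], which is at most 1. *)
have chernoff_le t : (chernoff t <= (expR (B t))%:E)%E.
  rewrite chernoffE; have [q /andP[q0 q1] ->] := pE.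
  rewrite -EFin_expe -EFinM lee_fin ger_pMr ?expR_gt0//.
  exact: exprn_ile1.
split; [|split; [|split; [|split; [|split]]]].
- move=> t; split; first by move=> w; exact: lne_W.
    exact: gammaE.
  rewrite /gammabar /seq_type2; congr (Q1 _); apply/seteqP; split => w /=.
    move=> /first_time_gtP noR n /andP[_ nt]; have := noR n nt.
    rewrite /rejection /= => /negP; rewrite -leNgt.
    by rewrite W_le_threshold.
  (* The stopping time also inspects time 0, which the event on the right omits; there
     [W_0 = 1 <= alpha^-1], so no rejection occurs. *)
  move=> GB; apply/first_time_gtP => -[|n] nt;
    rewrite /rejection/=; apply/negP; rewrite -leNgt.
    by rewrite /Wb /W /iid_product big_ord0 invf_ge1// ltW.
  by rewrite W_le_threshold// GB.
- move=> b b0 Zb.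
  have Zbpos := fine_Z_gt0 P1_ac_P0 r_version Zb.
  have rejE t := rejection_llr r_ge0 b0 Zbpos t alpha_gt0.
  split => // w; rewrite /stopping_time; congr (first_time _ _ w).
  by apply/funext => t; exact: rejE.
(* Since [c_beta = beta * KL - ln Z] and [beta * B t = l + t * ln Z], the condition says that the
   mean [t * KL] of [Gs t] is at most [B t]; the claim is then an inclusion of events. *)
- have key t : (t%:R%:E * c_coef P0 r P1 beta <= l%:E)%E ->
      (Q1 [set w | (Gs t w <= \int[Q1]_v Gs t v)%E] <= gamma t)%E.
    rewrite (c_coefE P1_ac_P0 r_version)// gammaE.
    rewrite (integral_G P1_ac_P0 r_version Q1_iid KL_fin).
    have [k ->] : exists k, KL P1 P0 = k%:E.
      exists (fine (KL P1 P0)); rewrite fineK//.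
      exact: (KL_fin_num P1_ac_P0 r_version).
    rewrite -!EFinM -?EFinN -?EFinD -?EFinM lee_fin => tk.
    apply: le_measure; rewrite ?inE; [exact: (measurable_G_le r_version)..|].
    move=> w /= /le_trans; apply; rewrite lee_fin /B /threshold /lambda.
    rewrite -(ler_pM2l beta_gt0) mulrBr; move: tk; rewrite -/l.
    have -> : beta * (l / beta) = l by field; rewrite gt_eqF.
    have -> : beta * (t%:R * (- beta^-1 * ln (fine (Z P0 r beta)))) =
      - (t%:R * ln (fine (Z P0 r beta))) by field; rewrite gt_eqF.
    by lra.
  move=> t; split; [exact: (integral_G P1_ac_P0 r_version)|exact: key|].
  move=> c0; apply: key; rewrite (le_trans (mule_ge0_le0 _ c0))// lee_fin//.
  exact: ltW.
- move=> t; split; first exact: le_trans (gamma_chernoff t) (chernoff_le t).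
  (* The goal becomes [t * lam <= l / beta]. It holds by sign when [lam <= 0]; for [lam > 0] its
     failure would give [t > l / (beta * lam)]. *)
  move=> vac; rewrite -expR0 ler_expR /B /threshold -/l -/lam.
  rewrite subr_ge0; have [lam_le0|lam_gt0] := leP lam 0.
    apply: (@le_trans _ _ 0); first by rewrite mulr_ge0_le0.
    by rewrite divr_ge0// ltW.
  rewrite leNgt; apply/negP => lt; apply: vac; split => //.
  by rewrite invfM mulrA ltr_pdivrMr.
- have lamE := lambda_gt0 P1_ac_P0 r_version beta_gt0 Z_fin.
  have lt1 : 0 < lam -> beta < 1.
    rewrite /lam lamE => Zlt1; rewrite ltNge; apply/negP => b1.
    by have := Z_ge1 P1_ac_P0 r_version beta_gt0 Z_fin b1; rewrite leNgt Zlt1.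
  (* The converse needs an event that separates [P0] from [P1]: for equal measures [Z = 1] and
     [lam = 0] at every [beta]. *)
  split=> // P01; split=> // b1; rewrite /lam lamE.
  exact: (Z_lt1 P1_ac_P0 r_version).
- move=> t; split => //.
  (* Strictness requires [t > 0]: at [t = 0] the extra factor is an empty power and equals 1. *)
  + move=> t0; rewrite chernoffE; have [q /andP[q0 q1] ->] := pE.
    rewrite lte_fin => q_lt1.
    rewrite -EFin_expe -EFinM lte_fin gtr_pMr ?expR_gt0//.
    by rewrite exprn_ilt1// -lt0n.
  + move=> KL01; rewrite chernoffE (ratio_gt0_prob1 P1_ac_P0 r_version KL01).
    by rewrite -EFin_expe expr1n mule1.
Qed.
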